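(* Let $n \geq 2$ and $r \geq 1$ be integers. Then there exists a number $L_r(n)$ such that for every prime power $q > L_r(n)$ with $r \mid q^n - 1$, the extension $\mathbb{F}_{q^n}/\mathbb{F}_q$ possesses the line property for $r$-primitive elements; that is, for every $\alpha \in \mathbb{F}_{q^n}^*$ and every $\theta \in \mathbb{F}_{q^n}$ with $\mathbb{F}_{q^n} = \mathbb{F}_q(\theta)$, there exists $x \in \mathbb{F}_q$ such that $\alpha(\theta + x)$ is $r$-primitive. Moreover, there exists a number $T_r(n) \leq L_r(n)$ such that for every prime power $q > T_r(n)$ with $r \mid q^n - 1$, the extension $\mathbb{F}_{q^n}/\mathbb{F}_q$ possesses the translate property for $r$-primitive elements; that is, for every $\theta \in \mathbb{F}_{q^n}$ with $\mathbb{F}_{q^n} = \mathbb{F}_q(\theta)$, there exists $x \in \mathbb{F}_q$ such that $\theta + x$ is $r$-primitive.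
   Context: For a prime power $q$ and integer $n \geq 2$, $\mathbb{F}_q$ denotes the finite field with $q$ elements and $\mathbb{F}_{q^n}$ its extension of degree $n$. For a positive integer $r$ with $r \mid q^n - 1$, an element of $\mathbb{F}_{q^n}^*$ is called $r$-primitive if its multiplicative order equals $(q^n-1)/r$. An element $\theta \in \mathbb{F}_{q^n}$ is a generator of the extension $\mathbb{F}_{q^n}/\mathbb{F}_q$ if $\mathbb{F}_{q^n} = \mathbb{F}_q(\theta)$. For a generator $\theta$, its set of translates is $\{\theta + x : x \in \mathbb{F}_q\}$, and for $\alpha \in \mathbb{F}_{q^n}^*$ the line of $\alpha$ and $\theta$ is $\{\alpha(\theta + x) : x \in \mathbb{F}_q\}$. The extension has the translate property (resp. line property) for $r$-primitive elements if every set of translates (resp. every line) contains an $r$-primitive element. *)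

(* Defs.v *)
From HB Require Import structures.
From mathcomp Require Import all_boot all_order all_algebra all_field.
Set Implicit Arguments. Unset Strict Implicit. Unset Printing Implicit Defensive.
Import GRing.Theory.
Local Open Scope ring_scope.

Definition has_mul_order (R : nzRingType) (x : R) (m : nat) : Prop :=
  (0 < m)%N /\ x ^+ m = 1 /\ (forall k : nat, (0 < k)%N -> (k < m)%N -> x ^+ k != 1).

Definition r_primitive (F : finFieldType) (L : fieldExtType F) (r : nat) (x : L) : Prop :=
  x != 0 /\ has_mul_order x ((#|F| ^ (\dim {:L}) - 1) %/ r)%N.

Definition is_generator (F : finFieldType) (L : fieldExtType F) (theta : L) : Prop :=
  <<1%VS; theta>>%VS = fullv.

Definition line_property (F : finFieldType) (L : fieldExtType F) (r : nat) : Prop :=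
  forall (alpha theta : L), alpha != 0 -> is_generator theta ->
    exists x : F, r_primitive r (alpha * (theta + x%:A)).

Definition translate_property (F : finFieldType) (L : fieldExtType F) (r : nat) : Prop :=
  forall (theta : L), is_generator theta ->
    exists x : F, r_primitive r (theta + x%:A).

(* Main.v *)
(* No bound for character sums is needed. Write q = #|F|, Q = q^n - 1 and let iota(x) be the
   index in L^* of the subgroup generated by alpha (theta + x), so that iota(x) = r is wanted.
   For d dividing Q, the x with d | iota(x) are those with (alpha (theta + x))^(Q/d) = 1.

   If d is at most a small power of q, Stepanov's method shows that every fibre of
   x |-> (theta + x)^(Q/d) has at most (1 + o(1)) q / d points. With the base-q digits c_i of
   Q/d this map is the polynomial G = prod_i (X + theta^(q^i))^c_i on F. The products
   (X + theta)^(l + q k) G^j have pairwise distinct orders of vanishing at - theta, because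
   d c_0 = -1 modulo q, hence are linearly independent; linear algebra yields a nonzero
   combination vanishing to high order on the fibre. There are at most d fibres, so the upper
   bound for all of them gives a lower bound for each.

   If p is a large prime divisor of Q, the products of n distinct alpha (theta + x) with
   p | iota(x) are distinct elements of a group of order Q/p, so there are few such x.

   An elementary sieve combines the two: Legendre's formula for the primes up to a multiple of
   log q, a union bound over the remaining primes, the sum of whose inverses is at most 1/2. *)
Require Import Defs.
From mathcomp Require Import all_boot all_order all_algebra all_field.
From mathcomp Require Import zify ring lra.
Set Implicit Arguments. Unset Strict Implicit. Unset Printing Implicit Defensive.
Import Order.TTheory GRing.Theory Num.Theory.

(** * Products of distinct primes and a Chebyshev bound *)

Lemma dvdn_prod_primes (s : seq nat) (m : nat) :
  uniq s -> all prime s -> all (fun p => p %| m) s -> \prod_(p <- s) p %| m.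
Proof.
elim: s => [|p s IHs] /=; first by rewrite big_nil dvd1n.
case/andP=> ps us /andP[pp prs] /andP[pm sm]; rewrite big_cons Gauss_dvd.
  by rewrite pm IHs.
rewrite prime_coprime // big_seq; apply/negP.
elim/big_rec: _ => [|x m' xs IH]; first by rewrite dvdn1 => /eqP p1; rewrite p1 in pp.
rewrite Euclid_dvdM // => /orP[|//].
rewrite dvdn_prime2 //; last exact: (allP prs).
move/eqP=> px.
by rewrite px xs in ps.
Qed.

(** The two equal middle coefficients both occur in the expansion of (1 + 1)^(2m+1). *)
Lemma central_binomial_le m : 'C(m.*2.+1, m) <= 4 ^ m.
Proof.
have E : 2 ^ m.*2.+1 = \sum_(i < m.*2.+2) 'C(m.*2.+1, i).
  by rewrite -[2]/(1 + 1) expnDn; apply: eq_bigr => i _; rewrite !exp1n !muln1.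
have: 'C(m.*2.+1, m) + 'C(m.*2.+1, m.+1) <= 2 ^ m.*2.+1.
  have hm : m < m.*2.+2 by lia.
  have hm1 : m.+1 < m.*2.+2 by lia.
  rewrite E (bigD1 (Ordinal hm)) //= (bigD1 (Ordinal hm1)) /=.
    by rewrite addnA leq_addr.
  by rewrite -val_eqE /=; lia.
have -> : 'C(m.*2.+1, m.+1) = 'C(m.*2.+1, m).
  by rewrite -bin_sub; [congr 'C(_, _); lia | lia].
by rewrite expnS -mul2n expnM -[2 ^ 2]/4; lia.
Qed.

(** Induction of Erdős: for odd y = 2m+1 > 1 the primes in [m+2, 2m+1] all divide C(2m+1, m), and an
    even y > 2 contributes no prime. *)
Lemma primorial_le y : \prod_(1 <= p < y.+1 | prime p) p <= 4 ^ y.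
Proof.
elim/ltn_ind: y => -[|[|[|y]]] IH; try by rewrite !unlock.
have [oy|ey] := boolP (odd y); last first.
  have Ey : y.+3 = y./2.+1.*2.+1 by move: (odd_double_half y); rewrite (negPf ey); lia.
  rewrite Ey; set m := y./2.+1.
  rewrite (big_cat_nat _ (n := m.+2)) //=; last by rewrite /m; lia.
  apply: (@leq_trans (4 ^ m.+1 * 'C(m.*2.+1, m))); last first.
    apply: leq_trans (leq_mul (leqnn _) (central_binomial_le m)) _.
    by rewrite -expnD leq_exp2l //; lia.
  apply: leq_mul; first by apply: IH; lia.
  apply: dvdn_leq; first by rewrite bin_gt0; lia.
  rewrite -big_filter; apply: dvdn_prod_primes; first by rewrite filter_uniq ?iota_uniq.
    by apply/allP=> p; rewrite mem_filter => /andP[].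
  apply/allP=> p; rewrite mem_filter mem_index_iota => /andP[pp /andP[h1 h2]].
  have pfact j : p %| j`! -> p <= j.
    elim: j => [|j IHj]; first by rewrite fact0 dvdn1 => /eqP p1; rewrite p1 in pp.
    rewrite factS Euclid_dvdM // => /orP[/dvdn_leq-> //|/IHj]; exact: leqW.
  have D : p %| m.*2.+1`! by rewrite dvdn_fact // prime_gt0 //=; lia.
  have := D; rewrite -(@bin_fact m.*2.+1 m); last by lia.
  rewrite Euclid_dvdM // => /orP[//|].
  by rewrite Euclid_dvdM // => /orP[] /pfact; lia.
have Hrec := IH y.+2 (ltnSn _).
rewrite big_mkcond big_nat_recr //= -big_mkcond /=.
rewrite ifN ?muln1; first by apply: leq_trans Hrec _; rewrite leq_exp2l.
apply/negP=> /even_prime[|]; first by lia.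
by rewrite /= oy.
Qed.

Lemma prod_distinct_primes_le (s : seq nat) y :
  uniq s -> all prime s -> all (fun p => p <= y) s -> \prod_(p <- s) p <= 4 ^ y.
Proof.
move=> us ps sy; apply: leq_trans (primorial_le y); apply: dvdn_leq.
  by apply: prodn_cond_gt0 => i; apply: prime_gt0.
apply: dvdn_prod_primes => //; apply/allP=> p ins.
have pp := allP ps p ins; have py := allP sy p ins.
rewrite big_mkcond (bigD1_seq p) /= ?iota_uniq ?pp ?dvdn_mulr //.
by rewrite mem_index_iota prime_gt0 //= ltnS.
Qed.

Lemma size_primes_exp (s : seq nat) b : all (fun p => b <= p) s ->
  b ^ size s <= \prod_(p <- s) p.
Proof.
elim: s => [|p s IHs] /=; first by rewrite big_nil.
by case/andP=> bp bs; rewrite big_cons expnS leq_mul ?IHs.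
Qed.

(** * Legendre's sieve over the small primes and a union bound over the others *)

Local Open Scope ring_scope.

(* Distinct primes dominate 2, 3, 4, ..., so the product is at least a telescoping one. *)
Lemma prod_one_sub_inv_ge (s : seq nat) : uniq s -> all prime s ->
  (size s).+1%:R^-1 <= \prod_(p <- s) (1 - p%:R^-1) :> rat.
Proof.
move=> us ps.
wlog so : s us ps / sorted geq s.
  have ps' := perm_sort geq s.
  move=> H; rewrite -(perm_big _ (permEl ps')) /= -(size_sort geq s).
  apply: H; rewrite ?sort_uniq ?(perm_all _ (permEl ps')) //.
  by apply: sort_sorted => a b; apply: leq_total.
have {us} : sorted gtn s by rewrite gtn_sorted_uniq_geq us.
have gtr : transitive gtn by move=> b a c /= ab bc; apply: ltn_trans bc ab.
elim: s ps {so} => [|p s IHs]; first by rewrite big_nil invr1.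
rewrite [all _ _]/= => /andP[pp ps]; rewrite /= (path_sortedE gtr).
case/andP=> sp ss; have {}IHs := IHs ps ss.
(* The entries of [s] are distinct integers in [2, p), so there are at most p - 2 of them. *)
have {}sp : ((size s).+2 <= p)%N.
  have : (size s <= size (iota 2 (p - 2)))%N.
    apply: uniq_leq_size; first by apply: sorted_uniq ss => // a; apply: ltnn.
    move=> a ain; rewrite mem_iota prime_gt1 ?(allP ps) //=.
    by have /= := allP sp a ain; lia.
  by rewrite size_iota; have := prime_gt1 pp; lia.
rewrite big_cons mulrC.
apply: (@le_trans _ _ ((size s).+1%:R^-1 * (1 - (size s).+2%:R^-1))).
  rewrite le_eqVlt; apply/orP; left; apply/eqP.
  have h1 : (size s).+1%:R != 0 :> rat by rewrite pnatr_eq0.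
  have h2 : (size s).+2%:R != 0 :> rat by rewrite pnatr_eq0.
  move: h1 h2; rewrite -[(size s).+2]addn1 natrD; set a := _%:R => h1 h2.
  by move: a h1 h2 => a h1 h2; field; rewrite h1 h2.
have q0 : 0 < (size s).+2%:R :> rat by rewrite ltr0n.
have q1 : p%:R^-1 <= (size s).+2%:R^-1 :> rat.
  by rewrite lef_pV2 ?ler_nat // posrE ltr0n //; lia.
have q2 : (size s).+2%:R^-1 <= 1 :> rat by rewrite invf_le1 // ler1n.
apply: ler_pM; rewrite ?invr_ge0 ?ler0n //.
  by rewrite subr_ge0.
by rewrite lerD2l lerN2.
Qed.

(** For [e = 1] these are the points whose index is [r] times a number free of the primes in [ps];
    [e] collects the primes imposed as divisors along the recursion. *)
Definition unsieved (X : finType) (f : X -> nat) (r e : nat) (ps : seq nat) :=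
  [set x | (r * e %| f x)%N && all (fun p => ~~ (r * p %| f x)%N) ps].

(** Split according to whether r p divides [f x]; coprimality merges the conditions for r e and r p
    into one for r e p. *)
Lemma card_unsieved_cons (X : finType) (f : X -> nat) r e p ps :
  (0 < r)%N -> coprime e p ->
  #|unsieved f r e ps| =
    (#|unsieved f r e (p :: ps)| + #|unsieved f r (e * p) ps|)%N.
Proof.
move=> r0 cop.
rewrite -(cardsID [set x | r * p %| f x]%N (unsieved f r e ps)) addnC.
congr (_ + _)%N; apply: eq_card => x; rewrite !inE.
  by rewrite andbCA.
rewrite andbAC; congr (_ && _).
apply/andP/idP => [[h1 h2]|h].
  have /dvdnP[s fs] : (r %| f x)%N by apply: dvdn_trans h1; apply: dvdn_mulr.
  move: h1 h2; rewrite fs [(s * r)%N]mulnC !dvdn_pmul2l //.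
  by rewrite Gauss_dvd // => -> ->.
by split; apply: dvdn_trans h; rewrite dvdn_pmul2l //; [exact: dvdn_mulr|exact: dvdn_mull].
Qed.

(* Legendre's sieve, with one error term for each of the 2^(size ps) subsets of ps. *)
Lemma card_unsieved (X : finType) (f : X -> nat) (q : rat) (Q D r : nat) (Err : rat) e ps :
  (0 < r)%N -> (0 < e)%N -> (0 < D)%N ->
  (forall d, (d %| Q)%N -> (d <= D)%N -> `| #|[set x | (d %| f x)%N]|%:R - q / d%:R| <= Err) ->
  uniq ps -> all prime ps -> all (fun p => coprime e p) ps ->
  (r * e * \prod_(p <- ps) p %| Q)%N -> (r * e * \prod_(p <- ps) p <= D)%N ->
  `| #|unsieved f r e ps|%:R - q / (r * e)%:R * \prod_(p <- ps) (1 - p%:R^-1)|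
    <= 2 ^+ size ps * Err.
Proof.
move=> r0 e0 D0 HErr; elim: ps e e0 => [|p ps IHs] e e0.
  move=> _ _ _; rewrite !big_nil !muln1 mulr1 mul1r => h1 h2.
  have -> : unsieved f r e [::] = [set x | (r * e %| f x)%N].
    by apply/setP=> x; rewrite !inE andbT.
  exact: HErr.
rewrite [uniq _]/= [all _ _]/= => /andP[pps ups] /andP[pp prs] /= /andP[cep ces].
rewrite !big_cons => hQ hD.
have p0 := prime_gt0 pp.
have H1 : `|#|unsieved f r e ps|%:R - q / (r * e)%:R * \prod_(p <- ps) (1 - p%:R^-1)|
    <= 2 ^+ size ps * Err.
  apply: IHs => //.
    by apply: dvdn_trans hQ; rewrite [(p * _)%N]mulnC mulnA dvdn_mulr.
  by apply: leq_trans hD; rewrite leq_mul // leq_pmull.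
have H2 : `|#|unsieved f r (e * p) ps|%:R
     - q / (r * (e * p))%:R * \prod_(p <- ps) (1 - p%:R^-1)| <= 2 ^+ size ps * Err.
  apply: IHs => //; rewrite ?muln_gt0 ?e0 //; last 2 first.
  - by rewrite -!mulnA in hQ *.
  - by rewrite -!mulnA in hD *.
  apply/allP=> x xs; rewrite coprimeMl (allP ces) //=.
  rewrite prime_coprime // dvdn_prime2 //; last exact: (allP prs).
  by apply: contraNneq pps => ->.
have E := card_unsieved_cons f ps r0 cep.
have re0 : (r * e)%:R != 0 :> rat by rewrite pnatr_eq0 -lt0n muln_gt0 r0.
have pn0 : p%:R != 0 :> rat by rewrite pnatr_eq0 -lt0n.
move/(congr1 (fun n => n%:R : rat)): E; rewrite natrD => E.
have -> : q / (r * e)%:R * ((1 - p%:R^-1) * \prod_(p <- ps) (1 - p%:R^-1)) =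
   q / (r * e)%:R * \prod_(p <- ps) (1 - p%:R^-1)
   - q / (r * (e * p))%:R * \prod_(p <- ps) (1 - p%:R^-1).
  have -> : (r * (e * p))%:R^-1 = (r * e)%:R^-1 * p%:R^-1 :> rat.
    by rewrite mulnA [in LHS]natrM invfM.
  by move: (_^-1) (p%:R^-1) => u v; ring.
rewrite exprS.
by move: H1 H2; rewrite !ler_norml => /andP[? ?] /andP[? ?]; apply/andP; split; lra.
Qed.

Lemma card_le_sum_cover (X : finType) (I : eqType) (s : seq I) (B : I -> {set X}) (A : {set X}) :
  (forall x, x \in A -> exists2 i, i \in s & x \in B i) -> (#|A| <= \sum_(i <- s) #|B i|)%N.
Proof.
move=> cov; suff : (#|A| <= #|\bigcup_(i <- s) B i|)%N.
  move=> h; apply: leq_trans h _.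
  elim/big_rec2: _ => [|i m C _ IH]; first by rewrite cards0.
  by apply: leq_trans (leq_card_setU _ _) _; rewrite leq_add2l.
apply/subset_leq_card/subsetP=> x /cov[i si xi].
by rewrite (big_rem i) //= inE xi.
Qed.

(** If no index equals [r], every point left after sieving by the primes up to [y] is caught by some
    prime p > y. For p <= T the same sieve bounds the points caught by p, with a main term smaller
    by a factor y + 1. As there are at most (y+1)/2 such primes, half of the main term remains and
    must be absorbed by the errors, a contradiction. *)
Lemma sieve_survivor (X : finType) (f : X -> nat) (q Err H : rat) (Q D T y r : nat) :
  (0 < r)%N -> (r %| Q)%N -> (0 < Q)%N -> 0 < q -> 0 <= H ->
  (forall x, (f x %| Q)%N) ->
  (forall d, (d %| Q)%N -> (d <= D)%N -> `| #|[set x | (d %| f x)%N]|%:R - q / d%:R| <= Err) ->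
  (forall p, prime p -> (p %| Q)%N -> (T < p)%N -> #|[set x | (p %| f x)%N]|%:R <= H) ->
  (0 < T)%N -> (r * 4 ^ y * T <= D)%N ->
  ((size [seq p <- primes Q | y < p]).*2 <= y.+1)%N ->
  2 * r%:R * (size (primes Q)).+1%:R *
    ((size (primes Q)).+1%:R * (4 ^ y)%:R * Err + (size (primes Q))%:R * H) < q ->
  exists x, f x = r.
Proof.
move=> r0 rQ Q0 q0 H0 fQ HErr HH T0 hD hmid hq.
set w := size (primes Q) in hq.
have [/existsP[x /eqP fx]|nex] := boolP [exists x, f x == r]; first by exists x.
exfalso.
have [Q' Q'E] : exists Q', Q = (r * Q')%N by case/dvdnP: rQ => Q' ->; exists Q'; rewrite mulnC.
have Q'0 : (0 < Q')%N by move: Q0; rewrite Q'E muln_gt0 => /andP[].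
have PQ : {subset primes Q' <= primes Q}.
  by move=> p; rewrite !mem_primes Q0 => /and3P[-> _ h]; rewrite Q'E dvdn_mull.
set ps := [seq p <- primes Q' | (p <= y)%N].
set s := [seq p <- primes Q' | (y < p)%N].
have ups : uniq ps by rewrite filter_uniq ?primes_uniq.
have prs : all prime ps by apply/allP=> p; rewrite mem_filter mem_primes => /and3P[].
have dps p : p \in ps -> (p %| Q')%N by rewrite mem_filter mem_primes => /and4P[].
have sw : (size s <= w)%N.
  apply: uniq_leq_size; first by rewrite filter_uniq ?primes_uniq.
  by move=> p; rewrite mem_filter => /andP[_ /PQ].
have psw : (size ps <= w)%N.
  apply: uniq_leq_size => //.
  by move=> p; rewrite mem_filter => /andP[_ /PQ].
have sy : ((size s).*2 <= y.+1)%N.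
  apply: leq_trans hmid; rewrite leq_double; apply: uniq_leq_size.
    by rewrite filter_uniq ?primes_uniq.
  by move=> p; rewrite !mem_filter => /andP[-> /PQ].
have Pps : (\prod_(p <- ps) p <= 4 ^ y)%N.
  by apply: prod_distinct_primes_le => //; apply/allP=> p; rewrite mem_filter => /andP[].
have Pps2 : (2 ^ size ps <= 4 ^ y)%N.
  by apply: leq_trans Pps; apply: size_primes_exp; apply/allP=> p /(allP prs)/prime_gt1.
have D0 : (0 < D)%N by apply: leq_trans hD; rewrite !muln_gt0 r0 T0 expn_gt0.
have Err0 : 0 <= Err by apply: le_trans (HErr 1%N (dvd1n _) D0); apply: normr_ge0.
pose V : rat := \prod_(p <- ps) (1 - p%:R^-1).
(* This crude lower bound on the density [V] is the source of the outer factor w + 1 in the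
   numerical hypothesis. *)
have V1 : w.+1%:R^-1 <= V.
  apply: le_trans (prod_one_sub_inv_ge ups prs).
  by rewrite lef_pV2 ?posrE ?ltr0n // ler_nat.
have w0 : 0 < w.+1%:R :> rat by rewrite ltr0n.
have V0 : 0 < V by apply: lt_le_trans V1; rewrite invr_gt0.
have E2 : 2 ^+ size ps * Err <= (4 ^ y)%:R * Err.
  by apply: ler_wpM2r => //; rewrite -natrX ler_nat.
have rr0 : 0 < r%:R :> rat by rewrite ltr0n.
have S1 : q / r%:R * V - (4 ^ y)%:R * Err <= #|unsieved f r 1 ps|%:R.
  have c1 : all (coprime 1) ps by apply/allP=> p _; rewrite coprime1n.
  have d1 : (r * 1 * \prod_(p <- ps) p %| Q)%N.
    rewrite muln1 Q'E dvdn_pmul2l //; apply: dvdn_prod_primes => //.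
    by apply/allP=> p /dps.
  have l1 : (r * 1 * \prod_(p <- ps) p <= D)%N.
    by apply: leq_trans hD; rewrite muln1 -[X in (X <= _)%N]muln1 leq_mul // leq_mul.
  have := le_trans (card_unsieved r0 (ltn0Sn 0) D0 HErr ups prs c1 d1 l1) E2.
  by rewrite -/V muln1 ler_norml => /andP[+ _]; rewrite lerBrDr addrC.
(* For a medium prime the small primes stay sieved out, which keeps the factor [V] in the bound.
   Beyond [T] the moduli may exceed [D], so only divisibility by p is retained. *)
pose B p := if (p <= T)%N then unsieved f r p ps else [set x | (p %| f x)%N].
have cov : (#|unsieved f r 1 ps| <= \sum_(p <- s) #|B p|)%N.
  apply: card_le_sum_cover => x; rewrite inE muln1 => /andP[/dvdnP[m fm] ax].
  have m1 : (1 < m)%N.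
    case: m fm => [|[|//]] fm.
      by have := fQ x; rewrite fm dvd0n => /eqP Q00; rewrite Q00 in Q0.
    by rewrite mul1n in fm; case/existsP: nex; exists x; rewrite fm.
  have pm := pdiv_prime m1.
  have rpf : (r * pdiv m %| f x)%N by rewrite fm mulnC dvdn_pmul2r // pdiv_dvd.
  have pQ' : pdiv m \in primes Q'.
    rewrite mem_primes pm Q'0 /=; have := dvdn_trans rpf (fQ x).
    by rewrite Q'E dvdn_pmul2l.
  have yp : (y < pdiv m)%N.
    rewrite ltnNge; apply/negP=> py.
    have /(allP ax) : pdiv m \in ps by rewrite mem_filter py.
    by rewrite rpf.
  exists (pdiv m); first by rewrite mem_filter yp.
  rewrite /B; case: ifP => _; rewrite inE ?rpf //.
  by apply: dvdn_trans rpf; apply: dvdn_mull.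
pose U := q / r%:R * V / y.+1%:R + (4 ^ y)%:R * Err + H.
have y0 : 0 < y.+1%:R :> rat by rewrite ltr0n.
have BU p : p \in s -> #|B p|%:R <= U.
  rewrite mem_filter => /andP[yp pQ].
  have pp : prime p by move: pQ; rewrite mem_primes => /andP[].
  have pdQ : (p %| Q')%N by move: pQ; rewrite mem_primes => /and3P[].
  have pn0 : 0 < p%:R :> rat by rewrite ltr0n prime_gt0.
  have e4 : 0 <= (4 ^ y)%:R * Err by rewrite mulr_ge0.
  have qrV : 0 < q / r%:R * V by rewrite !mulr_gt0 ?invr_gt0.
  rewrite /B /U; case: ifP => pT; last first.
    have : #|[set x | (p %| f x)%N]|%:R <= H.
      by apply: HH => //; rewrite ?Q'E ?dvdn_mull // ltnNge pT.
    move/le_trans; apply; rewrite lerDr addr_ge0 //.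
    by rewrite divr_ge0 // ltW.
  have cps : all (coprime p) ps.
    apply/allP=> a ains; rewrite prime_coprime // dvdn_prime2 ?(allP prs a) //.
    move: ains; rewrite mem_filter => /andP[ay _].
    by apply: contraTneq yp => ->; rewrite -leqNgt.
  have d1 : (r * p * \prod_(p <- ps) p %| Q)%N.
    rewrite Q'E -mulnA dvdn_pmul2l // Gauss_dvd.
      by rewrite pdQ /=; apply: dvdn_prod_primes => //; apply/allP=> a /dps.
    rewrite big_seq; elim/big_rec: _ => [|a m ains]; first exact: coprimen1.
    by rewrite coprimeMr => ->; rewrite (allP cps).
  have l1 : (r * p * \prod_(p <- ps) p <= D)%N.
    by apply: leq_trans hD; rewrite mulnAC leq_mul // leq_mul.
  have := le_trans (card_unsieved r0 (prime_gt0 pp) D0 HErr ups prs cps d1 l1) E2.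
  rewrite -/V ler_norml => /andP[_].
  have h : q / (r * p)%:R * V <= q / r%:R * V / y.+1%:R.
    by rewrite natrM invfM mulrA mulrAC ler_pM2l // lef_pV2 ?posrE // ler_nat.
  rewrite lerBlDr => /le_trans; apply.
  by rewrite addrAC [leRHS]addrC lerD2l (le_trans h) // lerDl.
have cov2 : #|unsieved f r 1 ps|%:R <= (size s)%:R * U.
  apply: (@le_trans _ _ (\sum_(p <- s) #|B p|)%:R); first by rewrite ler_nat.
  rewrite natr_sum big_seq; apply: (@le_trans _ _ (\sum_(p <- s | p \in s) U)).
    exact: ler_sum.
  by rewrite -big_seq big_const_seq count_predT iter_addr addr0 mulr_natl.
have sU : (size s)%:R * U <= q / r%:R * V / 2 + w%:R * ((4 ^ y)%:R * Err + H).
  rewrite /U -addrA mulrDr; apply: lerD.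
    have -> : (size s)%:R * (q / r%:R * V / y.+1%:R) = (q / r%:R * V) * ((size s)%:R / y.+1%:R) by ring.
    apply: ler_wpM2l; first by rewrite ltW // !mulr_gt0 ?invr_gt0.
    rewrite ler_pdivrMr //.
    have : (size s).*2%:R <= y.+1%:R :> rat by rewrite ler_nat.
    by rewrite -muln2 natrM; lra.
  by apply: ler_wpM2r; rewrite ?ler_nat // addr_ge0 // mulr_ge0.
have fin1 : q / r%:R * V <= 2 * (w.+1%:R * (4 ^ y)%:R * Err + w%:R * H).
  move: (le_trans S1 (le_trans cov2 sU)); rewrite -[w.+1]addn1 natrD.
  by move: (q / r%:R * V) (w%:R) ((4 ^ y)%:R) => a b c; lra.
have : q / r%:R * w.+1%:R^-1 <= 2 * (w.+1%:R * (4 ^ y)%:R * Err + w%:R * H).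
  apply: le_trans fin1; apply: ler_wpM2l => //.
  by rewrite ltW // mulr_gt0 ?invr_gt0.
rewrite ler_pdivrMr // ler_pdivrMr // => /(lt_le_trans hq).
by move: (w.+1%:R * (4 ^ y)%:R * Err + w%:R * H) (w.+1%:R) (r%:R) => Z W R; lra.
Qed.

(** * Linear systems and orders of vanishing of polynomials *)

Lemma homogeneous_solution (K : fieldType) (I J : finType) (w : I -> J -> K) :
  (#|J| < #|I|)%N ->
  exists a : I -> K, (exists i, a i != 0) /\ forall j, \sum_i a i * w i j = 0.
Proof.
move=> ltJI.
pose A := \matrix_(i < #|I|, j < #|J|) w (enum_val i) (enum_val j).
have ker0 : kermx A != 0.
  rewrite -mxrank_eq0 mxrank_ker subn_eq0 -ltnNge.
  exact: leq_ltn_trans (rank_leq_col A) ltJI.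
have v0 : nz_row (kermx A) != 0 by rewrite nz_row_eq0.
have /sub_kermxP vA := nz_row_sub (kermx A).
set v := nz_row _ in v0 vA.
exists (fun i => v 0 (enum_rank i)); split.
  case/rV0Pn: v0 => i vi; exists (enum_val i); by rewrite enum_valK.
move=> j; move/matrixP/(_ 0 (enum_rank j)): vA; rewrite !mxE => vA; rewrite -[RHS]vA.
rewrite (reindex_onto (@enum_val I I) enum_rank) /=; last by move=> i _; rewrite enum_rankK.
by apply: eq_big => [i|i _]; rewrite ?enum_valK ?eqxx // !mxE enum_rankK.
Qed.

(** Among the terms with nonzero coefficient the lowest order of vanishing at [x] is attained
    exactly once, so that term cannot be cancelled. *)
Lemma distinct_valuations_sum_neq0 (K : fieldType) (I : finType) (x : K) (v : I -> nat)
    (u : I -> {poly K}) (a : I -> K) :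
  injective v -> (forall i, ~~ root (u i) x) -> (exists i, a i != 0) ->
  \sum_i a i *: (('X - x%:P) ^+ v i * u i) != 0.
Proof.
move=> vinj ux [i0 ai0]; apply/negP=> /eqP sum0.
case: (@arg_minnP I i0 (fun i => a i != 0) v ai0) => i ai imin.
have dv : ('X - x%:P) ^+ (v i).+1 %| a i *: (('X - x%:P) ^+ v i * u i).
  move: sum0; rewrite (bigD1 i) //= => /eqP; rewrite addr_eq0 => /eqP->.
  rewrite dvdpNr; apply: (big_ind (fun p => _ %| p)) => [|p p'|j ji]; [exact: dvdp0|exact: dvdp_add|].
  have [->|aj] := eqVneq (a j) 0; first by rewrite scale0r dvdp0.
  rewrite dvdpZr // dvdp_mulr // dvdp_exp2l // ltn_neqAle imin // andbT.
  by apply: contra ji => /eqP/vinj->.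
move: dv; rewrite dvdpZr // exprSr dvdp_mul2l ?expf_neq0 ?polyXsubC_eq0 //.
by rewrite dvdp_XsubCl (negPf (ux i)).
Qed.

Lemma dvdp_prod_exp_XsubC (K : fieldType) (M : nat) (E : seq K) (P : {poly K}) :
  uniq E -> (forall c, c \in E -> ('X - c%:P) ^+ M %| P) ->
  \prod_(c <- E) ('X - c%:P) ^+ M %| P.
Proof.
elim: E => [|c E IHE] /=; first by rewrite big_nil dvd1p.
case/andP=> cE uE dE; rewrite big_cons Gauss_dvdp; last first.
  rewrite coprimep_sym prodrXl coprimep_expr // coprimep_expl // coprimep_XsubC.
  by rewrite root_prod_XsubC.
by rewrite dE ?mem_head ?IHE // => b bE; apply: dE; rewrite inE bE orbT.
Qed.

Lemma mult_roots_size (K : fieldType) (M : nat) (E : seq K) (P : {poly K}) :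
  P != 0 -> uniq E -> (forall c, c \in E -> ('X - c%:P) ^+ M %| P) ->
  (size E * M < size P)%N.
Proof.
move=> P0 uE dE; have := dvdp_leq P0 (dvdp_prod_exp_XsubC uE dE).
suff -> : size (\prod_(c <- E) ('X - c%:P) ^+ M) = (size E * M).+1 by [].
elim: E {uE dE} => [|c E IHE]; first by rewrite big_nil size_poly1.
rewrite big_cons size_Mmonic ?IHE ?size_exp_XsubC //= ?mulSn ?addSn ?addnS //.
  by rewrite -size_poly_eq0 size_exp_XsubC.
by apply: rpred_prod => b _; rewrite rpredX // monicXsubC.
Qed.

(** The substitution is invertible, so vanishing at [c] can be tested in a rescaled local
    variable. *)
Lemma affine_dvdp (K : fieldType) (c b : K) (M : nat) (P : {poly K}) :
  b != 0 -> 'X^M %| P \Po (c%:P + b *: 'X) -> ('X - c%:P) ^+ M %| P.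
Proof.
move=> b0 /dvdpP[R E].
have -> : P = (P \Po (c%:P + b *: 'X)) \Po (b^-1 *: ('X - c%:P)).
  rewrite -comp_polyA comp_polyD comp_polyC comp_polyZ comp_polyX scalerA divff //.
  by rewrite scale1r addrC subrK comp_polyXr.
by rewrite E comp_polyM comp_Xn_poly exprZn dvdp_mull // dvdpZr ?dvdpp // expf_neq0 // invr_eq0.
Qed.

Lemma base_digits (q n N : nat) : (N < q ^ n)%N ->
  N = (\sum_(i < n) (N %/ q ^ i %% q) * q ^ i)%N.
Proof.
elim: n N => [|n IHn] N; first by rewrite expn0 big_ord0; lia.
rewrite expnS => hN; rewrite big_ord_recl /= expn0 divn1 muln1.
have q0 : (0 < q)%N by case: q hN {IHn}.
rewrite {1}(divn_eq N q) addnC; congr (_ + _)%N.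
rewrite {1}(IHn (N %/ q)%N); last by rewrite ltn_divLR // mulnC.
rewrite big_distrl; apply: eq_bigr => i _ /=.
by rewrite /bump add1n -divnMA -expnS -mulnA -expnSr.
Qed.

(** The outer variable is a local parameter and the inner one the base point. A degree growing
    linearly with the order is stable under products, and it limits the number of scalar equations
    in the linear system. *)
Definition slope_bounded (K : nzRingType) (n D : nat) (w : {poly {poly K}}) :=
  forall m, (size (w`_m)%R <= (D + n * m).+1)%N.

Lemma slope_boundedM (K : nzRingType) n D1 D2 (w1 w2 : {poly {poly K}}) :
  slope_bounded n D1 w1 -> slope_bounded n D2 w2 -> slope_bounded n (D1 + D2) (w1 * w2).
Proof.
move=> h1 h2 m; rewrite coefM.
apply: leq_trans (size_sum _ _ _) _; apply/bigmax_leqP=> i _.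
apply: leq_trans (size_polyMleq _ _) _.
have im : (i <= m)%N by rewrite -ltnS.
have := h1 i; have := h2 (m - i)%N; have : (n * m = n * i + n * (m - i))%N by rewrite -mulnDr subnKC.
by lia.
Qed.

Lemma slope_boundedX (K : nzRingType) n (w : {poly {poly K}}) e :
  slope_bounded n 0 w -> slope_bounded n 0 (w ^+ e).
Proof.
move=> h; elim: e => [|e IHe]; last by rewrite exprS -[0%N]/(0 + 0)%N; apply: slope_boundedM.
by move=> m; rewrite expr0 coef1; case: eqP => _; rewrite ?size_poly1 ?size_poly0.
Qed.

Lemma slope_bounded_prod (K : nzRingType) n (I : finType) (w : I -> {poly {poly K}}) :
  (forall i, slope_bounded n 0 (w i)) -> slope_bounded n 0 (\prod_i w i).
Proof.
move=> h; apply: big_ind => [|u v hu hv|//].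
  (* The empty product is written as 0^0, to reuse the case of powers. *)
  by rewrite -(expr0 0); apply: slope_boundedX => m; rewrite coef0 size_poly0.
by rewrite -[0%N]/(0 + 0)%N; apply: slope_boundedM.
Qed.

Lemma slope_bounded_linear (K : nzRingType) n (g : {poly K}) :
  (size g <= n.+1)%N -> slope_bounded n 0 (1 + g *: 'X).
Proof.
move=> h [|[|m]]; rewrite coefD coefZ coef1 coefX /= ?mulr0 ?addr0 ?size_poly1 //.
  by rewrite add0r mulr1 add0n muln1.
by rewrite size_poly0.
Qed.

Lemma slope_boundedC (K : nzRingType) n D (g : {poly K}) :
  (size g <= D.+1)%N -> slope_bounded n D g%:P.
Proof.
move=> h m; rewrite coefC; case: eqP => [->|_]; last by rewrite size_poly0.
by rewrite muln0 addn0.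
Qed.

(** * Stepanov's auxiliary polynomial and its local expansions *)

Definition conjugate (K : fieldType) (q : nat) (theta : K) (i : nat) : K := theta ^+ (q ^ i).

(** Here X + theta^(q^i) stands in for (X + theta)^(q^i): if [q] is a power of the characteristic,
    both agree at points with c^q = c, while for N < q^n the degree falls from [N] to its digit
    sum. *)
Definition stepanov_base (K : fieldType) (q n N : nat) (theta : K) : {poly K} :=
  \prod_(i < n) ('X + (conjugate q theta i)%:P) ^+ (N %/ q ^ i %% q).

(** The exponent is split because a [q]-th power is constant up to order [q] near a point: q k adds
    that much to the degree, but only [k] to the complexity of the local expansion. *)
Definition stepanov_term (K : fieldType) (q n N : nat) (theta : K) (j k l : nat) : {poly K} :=
  ('X + theta%:P) ^+ (l + q * k) * stepanov_base q n N theta ^+ j.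

Lemma pnat_pchar_exp (R : comNzRingType) (q i : nat) : [pchar R].-nat q -> [pchar R].-nat (q ^ i)%N.
Proof. by move=> h; rewrite pnatX h. Qed.

Lemma expr_q_iter (R : nzRingType) (q i : nat) (c : R) : c ^+ q = c -> c ^+ (q ^ i) = c.
Proof. by move=> h; elim: i => [|i IHi]; rewrite ?expr1 // expnS exprM h. Qed.

Lemma conjugateD (K : fieldType) (q : nat) (theta c : K) i :
  [pchar K].-nat q -> c ^+ q = c -> c + conjugate q theta i = (c + theta) ^+ (q ^ i).
Proof.
by move=> hq hc; rewrite exprDn_pchar ?pnat_pchar_exp // expr_q_iter.
Qed.

Lemma horner_stepanov_base (K : fieldType) (q n N : nat) (theta c : K) :
  [pchar K].-nat q -> c ^+ q = c -> (N < q ^ n)%N ->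
  (stepanov_base q n N theta).[c] = (c + theta) ^+ N.
Proof.
move=> hq hc hN; rewrite horner_prod {2}(base_digits hN) expr_sum.
apply: eq_bigr => i _; rewrite horner_exp hornerD hornerX hornerC.
by rewrite (conjugateD _ i) // -exprM mulnC.
Qed.

(* The partial products that clear the denominators of 1 + X / (c + theta_i). *)
Definition cofactor_poly (K : fieldType) (q n : nat) (theta : K) (i : nat) : {poly K} :=
  \prod_(h < n | h != i :> nat) ('X + (conjugate q theta h)%:P).

(** Rescaling the local variable at c by this value, a norm of c + theta, clears all the
    denominators c + theta_i at once. *)
Definition norm_poly (K : fieldType) (q n : nat) (theta : K) : {poly K} :=
  \prod_(h < n) ('X + (conjugate q theta h)%:P).

(* Expansion of stepanov_term at c + norm_poly(c) Y for c in F_q, up to Y^q and the factor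
   z^j; the inner variable is c and the outer one is Y. *)
Definition local_term (K : fieldType) (q n N : nat) (theta : K) (j k l : nat) : {poly {poly K}} :=
  (('X + theta%:P) ^+ l * ('X + (conjugate q theta 1)%:P) ^+ k)%:P
  * (1 + cofactor_poly q n theta 0 *: 'X) ^+ l
  * (\prod_(i < n) (1 + cofactor_poly q n theta i *: 'X) ^+ (N %/ q ^ i %% q)) ^+ j.

Lemma size_cofactor_poly (K : fieldType) (q n : nat) (theta : K) i :
  (size (cofactor_poly q n theta i) <= n.+1)%N.
Proof.
apply: leq_trans (size_prod_leq _ _) _.
rewrite leq_subLR; apply: (@leq_trans (\sum_(h < n | h != i :> nat) 2).+1).
  by rewrite ltnS; apply: leq_sum => h _; rewrite size_XaddC.
rewrite sum_nat_const; have := max_card (fun h : 'I_n => h != i :> nat).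
by rewrite card_ord; set u := #|_|; lia.
Qed.

Lemma local_term_slope (K : fieldType) (q n N : nat) (theta : K) j k l :
  slope_bounded n (l + k) (local_term q n N theta j k l).
Proof.
rewrite -[(l + k)%N]addn0 -[(l + k)%N]addn0; apply: slope_boundedM.
  apply: slope_boundedM; last first.
    by apply/slope_boundedX/slope_bounded_linear/size_cofactor_poly.
  apply: slope_boundedC; apply: leq_trans (size_polyMleq _ _) _.
  have h (a : K) e : size (('X + a%:P) ^+ e) = e.+1.
    by rewrite -[a]opprK polyCN size_exp_XsubC.
  by rewrite !h addSn addnS.
apply/slope_boundedX/slope_bounded_prod => i.
by apply/slope_boundedX/slope_bounded_linear/size_cofactor_poly.
Qed.

Lemma cofactor_polyP (K : fieldType) (q n : nat) (theta c : K) (i : 'I_n) :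
  (norm_poly q n theta).[c] = (c + conjugate q theta i) * (cofactor_poly q n theta i).[c].
Proof.
by rewrite /norm_poly (bigD1 i) //= hornerM hornerD hornerX hornerC.
Qed.

(** After the substitution each X + theta_i becomes (c + theta_i)(1 + g_i Y), and the digits
    reassemble (c + theta)^N. The only discrepancy comes from the [q]-th powers, which by Frobenius
    differ from their constant term by a multiple of Y^q. *)
Lemma stepanov_term_local (K : fieldType) (q n N : nat) (theta c : K) j k l :
  [pchar K].-nat q -> c ^+ q = c -> (N < q ^ n)%N -> (0 < n)%N ->
  'X^q %| stepanov_term q n N theta j k l \Po (c%:P + (norm_poly q n theta).[c] *: 'X)
    - ((c + theta) ^+ N) ^+ j *: map_poly (horner_eval c) (local_term q n N theta j k l).
Proof.
move=> hq hc hN n0; set f := (norm_poly q n theta).[c].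
pose g i := (cofactor_poly q n theta i).[c].
have hg (i : 'I_n) : ('X + (conjugate q theta i)%:P) \Po (c%:P + f *: 'X)
   = (c + conjugate q theta i) *: (1 + g i *: 'X).
  rewrite comp_polyD comp_polyX comp_polyC scalerDr scalerA -cofactor_polyP -/f.
  by rewrite alg_polyC polyCD addrAC.
have hg0 : ('X + theta%:P) \Po (c%:P + f *: 'X) = (c + theta) *: (1 + g 0%N *: 'X).
  by have := hg (Ordinal n0); rewrite /conjugate /= expn0 expr1.
have gmap i : map_poly (horner_eval c) (1 + cofactor_poly q n theta i *: 'X) = 1 + g i *: 'X.
  by rewrite rmorphD rmorph1 /= map_polyZ map_polyX.
pose B := \prod_(i < n) (1 + g i *: 'X) ^+ (N %/ q ^ i %% q).
have hB : stepanov_base q n N theta \Po (c%:P + f *: 'X) = (c + theta) ^+ N *: B.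
  rewrite -(horner_stepanov_base theta hq hc hN) horner_prod /stepanov_base.
  rewrite rmorph_prod /= -scaler_prod; apply: eq_bigr => i _.
  by rewrite rmorphXn /= hg exprZn horner_exp hornerD hornerX hornerC.
have hmap : map_poly (horner_eval c) (local_term q n N theta j k l) =
   ((c + theta) ^+ l * (c + theta ^+ q) ^+ k) *: ((1 + g 0%N *: 'X) ^+ l * B ^+ j).
  rewrite /local_term 2!rmorphM /= map_polyC /= /horner_eval hornerM !horner_exp -/(horner_eval c).
  rewrite !hornerD !hornerX !hornerC /conjugate expn1 -mulrA mul_polyC.
  rewrite !rmorphXn /= gmap rmorph_prod /=; congr (_ *: (_ * _ ^+ _)).
  by apply: eq_bigr => i _; rewrite rmorphXn /= gmap.
have hqP : [pchar {poly K}].-nat q by rewrite (eq_pnat _ (pchar_poly K)).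
have hq1 : ('X + theta%:P) ^+ q \Po (c%:P + f *: 'X) =
   (c + theta ^+ q)%:P + f ^+ q *: 'X^q.
  rewrite exprDn_pchar // comp_polyD comp_Xn_poly exprDn_pchar // -!rmorphXn /= hc.
  by rewrite exprZn comp_polyC polyCD addrAC.
rewrite hmap /stepanov_term exprD exprM !comp_polyM.
have -> : ('X + theta%:P) ^+ l \Po (c%:P + f *: 'X) = (c + theta) ^+ l *: (1 + g 0%N *: 'X) ^+ l.
  by rewrite rmorphXn /= hg0 exprZn.
have -> : (('X + theta%:P) ^+ q) ^+ k \Po (c%:P + f *: 'X)
   = ((c + theta ^+ q)%:P + f ^+ q *: 'X^q) ^+ k.
  by rewrite rmorphXn /= hq1.
have -> : stepanov_base q n N theta ^+ j \Po (c%:P + f *: 'X) =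
   ((c + theta) ^+ N) ^+ j *: B ^+ j.
  by rewrite rmorphXn /= hB exprZn.
set u := (c + theta) ^+ l; set z := ((c + theta) ^+ N) ^+ j; set b := c + theta ^+ q.
set p1 := (1 + _) ^+ l; set p2 := B ^+ j.
have -> : u *: p1 * (b%:P + f ^+ q *: 'X^q) ^+ k * (z *: p2) - z *: (u * b ^+ k *: (p1 * p2))
   = (z * u) *: (p1 * p2) * ((b%:P + f ^+ q *: 'X^q) ^+ k - b%:P ^+ k).
  by rewrite -!mul_polyC !polyCM !rmorphXn /=; ring.
rewrite dvdp_mull // subrXX dvdp_mulr //.
by rewrite addrC addKr -mul_polyC dvdp_mull.
Qed.

(** Of the factors of [stepanov_base] only the one with i = 0 vanishes at - theta, since the other
    conjugates differ from theta. *)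
Lemma stepanov_term_valuation (K : fieldType) (q n N : nat) (theta : K) j k l :
  (0 < n)%N -> (forall i, (0 < i < n)%N -> conjugate q theta i != theta) ->
  exists2 u, ~~ root u (- theta) &
    stepanov_term q n N theta j k l = ('X - (- theta)%:P) ^+ (l + q * k + j * (N %% q)) * u.
Proof.
move=> n0 hconj.
exists ((\prod_(i < n | i != Ordinal n0)
   ('X + (conjugate q theta i)%:P) ^+ (N %/ q ^ i %% q)) ^+ j).
  rewrite rootE horner_exp expf_neq0 // horner_prod; apply/prodf_neq0 => i i0.
  rewrite horner_exp expf_neq0 // hornerD hornerX hornerC addrC subr_eq0.
  by apply: hconj; rewrite ltn_ord andbT lt0n.
rewrite /stepanov_term /stepanov_base (bigD1 (Ordinal n0)) //= expn0 divn1.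
by rewrite polyCN opprK exprD exprMn -exprM mulrA [(_ * j)%N]mulnC /conjugate expn0 expr1 -!exprD.
Qed.

(* Multiply by d and use d * (N %% q) = -1 modulo q. *)
Lemma valuations_injective (q n d N A j k l j' k' l' : nat) :
  (0 < n)%N -> (0 < q)%N -> (N * d = q ^ n - 1)%N -> (d * A <= q)%N ->
  (j < d)%N -> (j' < d)%N -> (l < A)%N -> (l' < A)%N ->
  (l + q * k + j * (N %% q) = l' + q * k' + j' * (N %% q))%N ->
  [/\ j = j', k = k' & l = l'].
Proof.
move=> n0 q0 hN dA jd jd' lA lA' E.
(* The witness comes from N d + 1 = q^n together with the division of [N] by [q]. *)
have [s hs] : exists s, (d * (N %% q) + 1 = q * s)%N.
  exists (q ^ n.-1 - N %/ q * d)%N; rewrite mulnBr -expnS prednK //.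
  have : (0 < q ^ n)%N by rewrite expn_gt0 q0.
  have := divn_eq N q; move: hN; set a := (N %/ q)%N; set b := (N %% q)%N.
  by move=> h1 h2 h3; nia.
have F (x y : nat) : (x < d)%N ->
   (d * (y + x * (N %% q)) + (d - 1) = (d * y + (d - 1 - x)) + q * (s * x))%N.
  by move=> xd; rewrite mulnA -hs; lia.
(* Both sides are below d A <= q, so a congruence modulo [q] suffices; quotient and remainder by [d]
   then give [l] and [j]. *)
have M : (d * l + (d - 1 - j) = d * l' + (d - 1 - j'))%N.
  have H := F j l jd; have H' := F j' l' jd'.
  have : (d * l + (d - 1 - j) = d * l' + (d - 1 - j') %[mod q])%N.
    have e1 : ((s * j + d * k) * q + (d * l + (d - 1 - j)) =
       (s * j' + d * k') * q + (d * l' + (d - 1 - j')))%N.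
      have := congr1 (muln d) E; move: H H'; move: (N %% q)%N => b; lia.
    by have := congr1 (modn^~ q) e1; rewrite !modnMDl.
  by rewrite !modn_small //; nia.
have lE : l = l'.
  have := congr1 (divn^~ d) M; have d0 : (0 < d)%N by lia.
  rewrite /= ![(d * _)%N]mulnC !divnMDl // !divn_small; [|lia|lia].
  by rewrite !addn0.
have jE : j = j' by lia.
by split=> //; move: E; rewrite jE lE; nia.
Qed.

Lemma size_stepanov_term (K : fieldType) (q n N : nat) (theta : K) j k l : (0 < q)%N ->
  (size (stepanov_term q n N theta j k l) <= (l + q * k + j * (n * q)).+1)%N.
Proof.
move=> q0; apply: leq_trans (size_polyMleq _ _) _.
have h (a : K) e : size (('X + a%:P) ^+ e) = e.+1.
  by rewrite -[a]opprK polyCN size_exp_XsubC.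
have hB : (size (stepanov_base q n N theta) <= (n * q).+1)%N.
  have -> : (n * q = \sum_(i < n) q)%N by rewrite sum_nat_const card_ord.
  rewrite /stepanov_base; elim/big_rec2: _ => [|i p m _ IH]; first by rewrite size_poly1.
  apply: leq_trans (size_polyMleq _ _) _; rewrite h.
  by have := @ltn_pmod (N %/ q ^ i) q q0; lia.
rewrite h; apply: (@leq_trans (l + q * k + ((size (stepanov_base q n N theta)).-1 * j).+1)).
  by rewrite addSn /= leq_add2l size_poly_exp_leq.
rewrite addnS ltnS leq_add2l mulnC leq_mul2l; apply/orP; right; lia.
Qed.

(* If A, k and M satisfy the counting inequality, some nonzero combination of the terms with
   exponents below d, k + 1 and A vanishes to order M at every point of E. *)
Lemma stepanov_bound (K : fieldType) (q n d N A k M : nat) (theta z : K) (E : seq K) :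
  [pchar K].-nat q -> (0 < n)%N -> (N * d = q ^ n - 1)%N -> (0 < d)%N ->
  (forall i, (0 < i < n)%N -> conjugate q theta i != theta) ->
  uniq E -> (forall c, c \in E -> c ^+ q = c) ->
  (forall c, c \in E -> c + theta != 0) ->
  (forall c, c \in E -> (c + theta) ^+ N = z) ->
  (M <= q)%N -> (d * A <= q)%N -> (M * (A + k.+1 + n * M) < d * k.+1 * A)%N ->
  (size E * M <= A + q * k + d * n * q)%N.
Proof.
move=> hq n0 hN d0 hconj uE Eq E0 Ez Mq dAq hcount.
have q0 : (0 < q)%N by case/andP: hq.
have Nq : (N < q ^ n)%N.
  have : (0 < q ^ n)%N by rewrite expn_gt0 q0.
  by nia.
pose B := (A + k.+1 + n * M)%N.
(* The local coefficients are required to vanish identically in c, so a single system, of size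
   independent of [E], serves all the points sharing the value [z]. *)
pose w (i : 'I_d * 'I_k.+1 * 'I_A) (b : 'I_M * 'I_B) : K :=
  z ^+ i.1.1 * ((local_term q n N theta i.1.1 i.1.2 i.2)`_(b.1))`_(b.2).
have [|a [an0 aw]] := @homogeneous_solution K _ _ w.
  by rewrite !card_prod !card_ord.
pose P := \sum_i a i *: stepanov_term q n N theta i.1.1 i.1.2 i.2.
have P0 : P != 0.
  have hu (i : 'I_d * 'I_k.+1 * 'I_A) : exists u, ~~ root u (- theta) /\
    stepanov_term q n N theta i.1.1 i.1.2 i.2 =
      ('X - (- theta)%:P) ^+ (i.2 + q * i.1.2 + i.1.1 * (N %% q)) * u.
    have [u h1 h2] := stepanov_term_valuation N i.1.1 i.1.2 i.2 n0 hconj.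
    by exists u.
  case/fin_all_exists: hu => u hu.
  rewrite /P (eq_bigr _ (fun i _ => congr1 _ (proj2 (hu i)))).
  apply: distinct_valuations_sum_neq0 => // [|i]; last by case: (hu i).
  move=> [[j1 k1] l1] [[j2 k2] l2] /=.
  case/(valuations_injective n0 q0 hN dAq) => // e1 e2 e3.
  by congr (_, _, _); apply: val_inj.
have dvdE c : c \in E -> ('X - c%:P) ^+ M %| P.
  move=> cE; have hc := Eq c cE.
  have nc0 : (norm_poly q n theta).[c] != 0.
    rewrite horner_prod; apply/prodf_neq0 => i _.
    by rewrite hornerD hornerX hornerC conjugateD // expf_neq0 // E0.
  apply: (affine_dvdp nc0); set ell := c%:P + _.
  pose W := \sum_i (a i * z ^+ i.1.1) *:
     map_poly (horner_eval c) (local_term q n N theta i.1.1 i.1.2 i.2).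
  have dW : 'X^M %| W.
    have take0 : take_poly M W = 0.
      apply/polyP=> m; rewrite coef_take_poly coef0; case: ifP => // mM.
      rewrite coef_sum; under eq_bigr do rewrite coefZ coef_map /= /horner_eval.
      under eq_bigr => i _.
        rewrite (@horner_coef_wide _ B); last first.
          apply: leq_trans (local_term_slope _ _ _ _ _ _ _ _) _.
          case: i => [[j1 k1] l1] /=; rewrite /B.
          have := ltn_ord k1; have := ltn_ord l1.
          have : (n * m <= n * M)%N by rewrite leq_mul2l ltnW ?orbT.
          by lia.
        rewrite mulr_sumr; over.
      rewrite exchange_big /= big1 // => b _.
      have := aw (Ordinal mM, b); rewrite /w /= => h.
      apply: etrans (mul0r (c ^+ b)); rewrite -[in RHS]h mulr_suml.
      by apply: eq_bigr => i _; rewrite !mulrA.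
    by rewrite -[W](poly_take_drop M) take0 add0r dvdp_mull.
  have : 'X^M %| P \Po ell - W.
    apply: (@dvdp_trans _ 'X^q); first exact: dvdp_exp2l.
    rewrite /P /W rmorph_sum /= -sumrB.
    apply: (big_ind (fun p => _ %| p)) => [|p p'|i _]; [exact: dvdp0|exact: dvdp_add|].
    rewrite comp_polyZ -scalerA -scalerBr.
    have := stepanov_term_local theta i.1.1 i.1.2 i.2 hq hc Nq n0.
    by rewrite Ez // => h; rewrite -mul_polyC dvdp_mull.
  by rewrite dvdp_subl.
have := mult_roots_size P0 uE dvdE.
have : (size P <= (A + q * k + d * n * q).+1)%N.
  apply: leq_trans (size_sum _ _ _) _; apply/bigmax_leqP=> i _.
  apply: leq_trans (size_scale_leq _ _) _.
  case: i => [[j1 k1] l1] /=; apply: leq_trans (size_stepanov_term _ _ _ _ _ _ q0) _.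
  have := ltn_ord j1; have := ltn_ord k1; have := ltn_ord l1.
  have : (q * k1 <= q * k)%N by rewrite leq_mul2l -ltnS ltn_ord orbT.
  have : (j1 * (n * q) <= d * (n * q))%N by rewrite leq_mul2r ltnW ?orbT.
  by lia.
by lia.
Qed.

(** Take M = d k and A = (n+1) d (k+1)^2. Once d k A is cancelled, the counting inequality asks for
    A > k (k + 1 + n d k), and the parts d (k+1)^2 and n d (k+1)^2 of [A] dominate the two summands.
    For k > 0 the outcome is at most q/d + 2 n q/k points. *)
Lemma stepanov_bound_param (K : fieldType) (q n d N k : nat) (theta z : K) (E : seq K) :
  [pchar K].-nat q -> (0 < n)%N -> (N * d = q ^ n - 1)%N -> (0 < d)%N ->
  (forall i, (0 < i < n)%N -> conjugate q theta i != theta) ->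
  uniq E -> (forall c, c \in E -> c ^+ q = c) ->
  (forall c, c \in E -> c + theta != 0) ->
  (forall c, c \in E -> (c + theta) ^+ N = z) ->
  (n.+1 * d ^ 2 * k.+1 ^ 2 <= q)%N ->
  (size E * (d * k) <= q * k + 2 * d * n * q)%N.
Proof.
move=> hq n0 hN d0 hconj uE Eq E0 Ez hqk.
pose A := (n.+1 * d * k.+1 ^ 2)%N.
have dA : (d * A <= q)%N by apply: leq_trans hqk; rewrite /A leq_eqVlt; apply/orP; left; apply/eqP; ring.
have Aq : (A <= q)%N by apply: leq_trans dA; rewrite leq_pmull.
have kA : (k < A)%N.
  by apply: (@leq_trans (k.+1 ^ 2)%N); rewrite ?leq_pmull ?muln_gt0 // leq_pmull.
have Mq : (d * k <= q)%N by apply: leq_trans dA; rewrite leq_mul2l ltnW ?orbT.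
have hc : (d * k * (A + k.+1 + n * (d * k)) < d * k.+1 * A)%N.
  have e1 : (d * k.+1 * A = d * k * A + d * A)%N by ring.
  rewrite e1 -addnA mulnDr ltn_add2l -mulnA ltn_pmul2l //.
  have h1 : (k * k.+1 <= d * k.+1 ^ 2 - 1)%N by nia.
  have h2 : (k * (n * (d * k)) <= n * d * k.+1 ^ 2)%N by nia.
  have -> : (A = d * k.+1 ^ 2 + n * d * k.+1 ^ 2)%N by rewrite /A; ring.
  have : (0 < d * k.+1 ^ 2)%N by rewrite muln_gt0 d0.
  by rewrite mulnDr; lia.
have := stepanov_bound hq n0 hN d0 hconj uE Eq E0 Ez Mq dA hc.
have : (q <= d * n * q)%N by rewrite leq_pmull // muln_gt0 d0.
by lia.
Qed.

(** * Frobenius and generators in extensions of finite fields *)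

Lemma card_fieldExt_expf (F : finFieldType) (L : fieldExtType F) (x : L) :
  x ^+ (#|F| ^ \dim {:L}) = x.
Proof.
pose fL := finvect_type L.
have := @expf_card fL x.
by rewrite -(card_vspacef (Vector.class fL)) card_vspace.
Qed.

Lemma card_fieldExt_le (F : finFieldType) (L : fieldExtType F) (m : nat) : (1 < m)%N ->
  (forall x : L, x ^+ m = x) -> (#|F| ^ \dim {:L} <= m)%N.
Proof.
move=> m1 hm; pose fL := finvect_type L.
have <- : #|fL| = (#|F| ^ \dim {:L})%N.
  by rewrite -(card_vspacef (Vector.class fL)) card_vspace.
have szp : size ('X^m - 'X : {poly fL}) = m.+1.
  by rewrite size_polyDl size_polyXn // size_polyN size_polyX.
have := @max_poly_roots fL ('X^m - 'X) (enum fL).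
rewrite szp -cardE ltnS; apply.
- by rewrite -size_poly_eq0 szp.
- by apply/allP=> x _; rewrite rootE !hornerE /= (hm x) subrr.
- exact: enum_uniq.
Qed.

Lemma card_pchar_nat (F : finFieldType) (L : fieldExtType F) : [pchar L].-nat #|F|.
Proof.
rewrite (eq_pnat _ (pchar_lalg L)).
have [p pp pF] := finPcharP F.
have -> : #|F| = (p ^ logn p #|F|)%N by rewrite -(card_pprimeChar pF).
by rewrite pnatX (eq_pnat _ (pcharf_eq pF)) pnat_id.
Qed.

Lemma in_alg_expf (F : finFieldType) (L : fieldExtType F) (x : F) : (x%:A : L) ^+ #|F| = x%:A.
Proof. by rewrite -(rmorphXn (in_alg L)) expf_card. Qed.

Lemma horner_in_alg_frobenius (F : finFieldType) (L : fieldExtType F) (p : {poly F}) (x : L) i :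
  (map_poly (in_alg L) p).[x] ^+ (#|F| ^ i) = (map_poly (in_alg L) p).[conjugate #|F| x i].
Proof.
elim/poly_ind: p => [|p c IHp].
  by rewrite rmorph0 !horner0 expr0n expn_eq0 gtn_eqF // ltnW // card_finNzRing_gt1.
rewrite rmorphD rmorphM /= map_polyX map_polyC /= !hornerMXaddC.
rewrite exprDn_pchar ?pnat_pchar_exp ?card_pchar_nat // exprMn IHp.
by rewrite (expr_q_iter _ (in_alg_expf L c)).
Qed.

(** If theta were fixed by the [i]-th Frobenius power, so would be all of F(theta) = L, which is too
    large for the roots of X^(q^i) - X. *)
Lemma generator_conjugate_neq (F : finFieldType) (L : fieldExtType F) (theta : L) i :
  is_generator theta -> (0 < i < \dim {:L})%N -> conjugate #|F| theta i != theta.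
Proof.
move=> gen /andP[i0 iL]; apply/eqP=> E.
have q1 := card_finNzRing_gt1 F.
have m1 : (1 < #|F| ^ i)%N by rewrite -(exp1n i) ltn_exp2r.
have : (#|F| ^ \dim {:L} <= #|F| ^ i)%N.
  apply: card_fieldExt_le => // x.
  have : x \in <<1%VS; theta>>%VS by rewrite gen memvf.
  case/Fadjoin_polyP=> p /polyOver1P[p' ->] ->.
  by rewrite horner_in_alg_frobenius E.
by rewrite leq_exp2l // leqNgt iL.
Qed.

(** The minimal polynomial of a generator has degree the dimension of the extension. *)
Lemma generator_root_eq0 (F : finFieldType) (L : fieldExtType F) (theta : L) (p : {poly F}) :
  is_generator theta -> (size p <= \dim {:L})%N -> root (map_poly (in_alg L) p) theta -> p = 0.
Proof.
move=> gen szp rp; apply/eqP; rewrite -(map_poly_eq0 (in_alg L)); apply/negP=> /negP p0.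
have over : map_poly (in_alg L) p \is a polyOver 1%VS by apply/polyOver1P; exists p.
have := dvdp_leq p0 (minPoly_dvdp over rp).
rewrite size_minPoly size_map_poly.
have := dim_Fadjoin 1%AS theta; rewrite gen dimv1 muln1 => <-.
by rewrite ltnNge szp.
Qed.

Lemma generator_add_neq0 (F : finFieldType) (L : fieldExtType F) (theta : L) (x : F) :
  is_generator theta -> (1 < \dim {:L})%N -> theta + x%:A != 0.
Proof.
move=> gen dL; apply/eqP=> h.
pose p : {poly F} := 'X + x%:P.
have szp : size p = 2%N by rewrite size_XaddC.
suff p0 : p = 0 by rewrite p0 size_poly0 in szp.
apply: (generator_root_eq0 gen); first by rewrite szp.
by rewrite rmorphD /= map_polyX map_polyC rootE hornerD hornerX hornerC /= h.
Qed.

(** * Points of a line lying in a subgroup *)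

(** The scalar [alpha] is absorbed into the target value z / alpha^N, so lines cost no more than
    translates. *)
Lemma card_line_fiber_le (F : finFieldType) (L : fieldExtType F) (alpha theta z : L) (n N d k : nat) :
  \dim {:L} = n -> (1 < n)%N -> alpha != 0 -> is_generator theta ->
  (N * d = #|F| ^ n - 1)%N -> (0 < d)%N -> (n.+1 * d ^ 2 * k.+1 ^ 2 <= #|F|)%N ->
  (#|[set x : F | (alpha * (theta + x%:A)) ^+ N == z]| * (d * k) <=
     #|F| * k + 2 * d * n * #|F|)%N.
Proof.
move=> dL n1 al0 gen hN d0 hk; set S := [set x | _].
pose E := [seq x%:A : L | x <- enum S].
have -> : #|S| = size E by rewrite size_map -cardE.
have EP c : c \in E -> exists2 x : F, x \in S & c = x%:A.
  by case/mapP=> x; rewrite mem_enum => xS ->; exists x.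
apply: (@stepanov_bound_param _ #|F| n d N k theta (z / alpha ^+ N)) => //.
- exact: card_pchar_nat.
- exact: ltnW.
- by move=> i; rewrite -dL; apply: generator_conjugate_neq.
- by rewrite map_inj_uniq ?enum_uniq //; apply: (fmorph_inj (in_alg L)).
- by move=> c /EP[x _ ->]; apply: in_alg_expf.
- by move=> c /EP[x _ ->]; rewrite addrC generator_add_neq0 // dL.
- move=> c /EP[x xS ->]; move: xS; rewrite inE exprMn => /eqP <-.
  by rewrite [_ * _ / _]mulrAC divff ?expf_neq0 // mul1r addrC.
Qed.

(** The [N]-th powers take at most [d] values, and each fibre has at most q/d + 2 n q/k points.
    Since the fibres cover all of [F], the one over 1 falls short of q/d by at most d - 1 such
    errors. *)
Lemma card_line_subgroup (F : finFieldType) (L : fieldExtType F) (alpha theta : L) (n N d k : nat) :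
  \dim {:L} = n -> (1 < n)%N -> alpha != 0 -> is_generator theta ->
  (N * d = #|F| ^ n - 1)%N -> (0 < d)%N -> (0 < k)%N -> (n.+1 * d ^ 2 * k.+1 ^ 2 <= #|F|)%N ->
  `| #|[set x : F | (alpha * (theta + x%:A)) ^+ N == 1]|%:R - #|F|%:R / d%:R |
    <= 2 * d%:R * n%:R * #|F|%:R / k%:R :> rat.
Proof.
move=> dL n1 al0 gen hN d0 k0 hk.
pose S (z : L) := [set x : F | (alpha * (theta + x%:A)) ^+ N == z].
pose U := (#|F| * k + 2 * d * n * #|F|)%N.
have up z : (#|S z| * (d * k) <= U)%N by exact: card_line_fiber_le.
(* The value 1 is adjoined so that its fibre can be split off even when it is empty. *)
pose Z := undup (1 :: [seq (alpha * (theta + x%:A)) ^+ N | x : F]).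
have Zd : (size Z <= d)%N.
  apply: max_unity_roots => //; last exact: undup_uniq.
  apply/allP=> z; rewrite mem_undup inE => /predU1P[->|]; first by rewrite /root_of_unity rootE !hornerE expr1n subrr.
  case/mapP=> x _ ->; rewrite /root_of_unity rootE !hornerE -exprM hN.
  have h := card_fieldExt_expf (alpha * (theta + x%:A)); rewrite dL in h.
  have b0 : alpha * (theta + x%:A) != 0 by rewrite mulf_neq0 ?generator_add_neq0 ?dL.
  rewrite subr_eq0; apply/eqP/(mulfI b0).
  by rewrite -exprS mulr1 subn1 prednK ?h // expn_gt0 (ltnW (card_finNzRing_gt1 F)).
have cov : (#|F| <= \sum_(z <- Z) #|S z|)%N.
  rewrite -cardsT; apply: card_le_sum_cover => x _.
  exists ((alpha * (theta + x%:A)) ^+ N); last by rewrite inE.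
  by rewrite mem_undup inE; apply/orP; right; apply: image_f.
have lo : (#|F| * (d * k) <= #|S 1%R| * (d * k) + d.-1 * U)%N.
  apply: leq_trans (leq_mul cov (leqnn _)) _.
  have Z1 : 1 \in Z by rewrite mem_undup mem_head.
  rewrite (big_rem 1) //= mulnDl leq_add2l.
  have szr : (size (rem 1%R Z) <= d.-1)%N by rewrite size_rem //; lia.
  apply: (@leq_trans (size (rem 1%R Z) * U)); last by rewrite leq_mul2r szr orbT.
  rewrite big_distrl /=; elim: (rem 1%R Z) => [|z r IHr]; first by rewrite big_nil.
  by rewrite big_cons /= mulSn leq_add.
have {up} up := up 1.
have dR : 0 < d%:R :> rat by rewrite ltr0n.
have kR : 0 < k%:R :> rat by rewrite ltr0n.
have dkR : 0 < (d * k)%:R :> rat by rewrite ltr0n muln_gt0 d0.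
have {}up : #|S 1|%:R * (d%:R * k%:R) <= #|F|%:R * k%:R + 2 * d%:R * n%:R * #|F|%:R :> rat.
  by rewrite -!natrM -natrD ler_nat.
have {}lo : #|F|%:R * (d%:R * k%:R) <= #|S 1|%:R * (d%:R * k%:R) +
    (d%:R - 1) * (#|F|%:R * k%:R + 2 * d%:R * n%:R * #|F|%:R) :> rat.
  have -> : d%:R - 1 = d.-1%:R :> rat by rewrite -{1}(prednK d0) -natr1 addrK.
  by rewrite -!natrM -!natrD -!natrM -natrD ler_nat.
have nR : 0 <= n%:R * #|F|%:R :> rat by rewrite mulr_ge0.
have d1R : 1 <= d%:R :> rat by rewrite ler1n.
rewrite -/(S 1); move: dR kR up lo nR d1R; clear.
move: (#|S 1|%:R) (d%:R) (k%:R) (#|F|%:R) (n%:R) => s d' k' q' n' d0 k0 up lo nq d1.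
have dk0 : 0 < d' * k' by rewrite mulr_gt0.
have -> : s - q' / d' = (s * (d' * k') - q' * k') / (d' * k') by field; rewrite !gt_eqF.
have -> : 2 * d' * n' * q' / k' = (2 * d' * d' * n' * q') / (d' * k') by field; rewrite !gt_eqF.
have e0 : 0 <= d' * (n' * q') by rewrite mulr_ge0 // ltW.
have e1 : d' * (n' * q') <= d' * (d' * (n' * q')) by rewrite -[leLHS]mul1r ler_wpM2r.
rewrite normrM [`|_^-1|]gtr0_norm ?invr_gt0 //.
apply: ler_wpM2r; first by rewrite invr_ge0 ltW.
by rewrite ler_norml; apply/andP; split; lra.
Qed.

(* Products over n-subsets of the line are distinct, since monic polynomials of degree n over F
   that agree at theta differ by a polynomial of degree less than n. *)
Lemma bin_card_line_subgroup (F : finFieldType) (L : fieldExtType F) (alpha theta : L) (n N : nat) :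
  \dim {:L} = n -> (0 < N)%N -> alpha != 0 -> is_generator theta ->
  ('C(#|[set x : F | ((alpha * (theta + x%:A)) ^+ N == 1)%R]|, n) <= N)%N.
Proof.
move=> dL N0 al0 gen; set S := [set x | _].
rewrite -cards_draws; set D := [set A | _ & _].
pose poly_of (A : {set F}) : {poly F} := \prod_(x in A) ('X - (- x)%:P).
pose pr (A : {set F}) : L := \prod_(x in A) (alpha * (theta + x%:A)).
have prE A : pr A = alpha ^+ #|A| * (map_poly (in_alg L) (poly_of A)).[theta].
  rewrite /pr big_split /= prodr_const rmorph_prod horner_prod; congr (_ * _).
  apply: eq_bigr => x _; rewrite rmorphB /= map_polyX map_polyC /= hornerD hornerX hornerN hornerC.
  by rewrite scaleNr opprK.
have inj : {in D &, injective pr}.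
  move=> A B; rewrite !inE => /andP[_ /eqP cA] /andP[_ /eqP cB].
  rewrite !prE cA cB => /(mulfI (expf_neq0 _ al0)) hAB.
  have sz (C : {set F}) : #|C| = n -> size (poly_of C) = n.+1.
    by move=> cC; rewrite /poly_of -big_enum size_prod_XsubC -cardE cC.
  have mon (C : {set F}) : poly_of C \is monic by rewrite /poly_of -big_enum monic_prod_XsubC.
  have : poly_of A - poly_of B = 0.
    apply: (generator_root_eq0 gen); last first.
      by rewrite rmorphB rootE hornerD hornerN hAB subrr.
    rewrite dL; apply/leq_sizeP=> i; rewrite leq_eqVlt => /predU1P[<-|ni]; rewrite coefB.
      have lead (C : {set F}) : #|C| = n -> (poly_of C)`_n = 1.
        by move=> cC; have /monicP := mon C; rewrite lead_coefE sz.
      by rewrite !lead // subrr.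
    by rewrite !nth_default ?subrr // sz.
  move/eqP; rewrite subr_eq0 => /eqP pAB; apply/setP=> x.
  have rt (C : {set F}) : (x \in C) = root (poly_of C) (- x).
    rewrite /poly_of -(big_enum _ _ (mem C)) /= -(big_map -%R xpredT (fun y => 'X - y%:P)) root_prod_XsubC.
    by rewrite mem_map ?mem_enum //; apply: oppr_inj.
  by rewrite !rt pAB.
(* The products are [N]-th roots of unity, and a field has at most [N] of them. *)
rewrite cardE -(size_map pr); apply: max_unity_roots => //.
  apply/allP=> z /mapP[A]; rewrite mem_enum inE => /andP[/subsetP AS _] ->.
  rewrite /root_of_unity rootE !hornerE subr_eq0 /pr -prodrXl; apply/eqP.
  by apply: big1 => x /AS; rewrite inE => /eqP.
by rewrite map_inj_in_uniq ?enum_uniq // => A B; rewrite !mem_enum; apply: inj.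
Qed.

(** * Numerical estimates and the choice of parameters *)

Lemma leq_wexp2r (a b e : nat) : (a <= b)%N -> (a ^ e <= b ^ e)%N.
Proof. by case: e => [|e] ab; rewrite ?expn0 // leq_exp2r. Qed.

Lemma leq_ffact_expn (h n m : nat) : (m <= n)%N -> ((h - n) ^ m <= h ^_ m)%N.
Proof.
elim: m => [|m IHm] mn; first by rewrite expn0 ffactn0.
by rewrite ffactnSr expnSr; apply: leq_mul; [exact: IHm (ltnW mn)|rewrite leq_sub2l // ltnW].
Qed.

Lemma fact_leq_expn (n : nat) : (n`! <= n ^ n)%N.
Proof.
suff H m : (m <= n)%N -> (m`! <= n ^ m)%N by apply: H.
by elim: m => [|m IHm] mn; rewrite ?expn0 // factS expnS leq_mul // IHm // ltnW.
Qed.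

(** Compare [n]-th powers: (h - n)^n is at most n! C(h, n), hence at most n^n N, while N t^n <
    q^n. *)
Lemma bin_large_bound (h n N p q t : nat) : (0 < n)%N ->
  ('C(h, n) <= N)%N -> (N * p < q ^ n)%N -> (t ^ n <= p)%N -> (h * t <= n * t + n * q)%N.
Proof.
move=> n0 hC hN tp.
suff : ((h - n) * t <= n * q)%N by rewrite mulnBl; lia.
rewrite -(leq_exp2r _ _ n0) expnMn [leqRHS]expnMn.
apply: (@leq_trans (n`! * (N * p))); last by rewrite leq_mul ?fact_leq_expn // ltnW.
rewrite mulnA leq_mul //; apply: leq_trans (leq_ffact_expn h (leqnn n)) _.
by rewrite -bin_ffact mulnC leq_mul.
Qed.

(** The product of the primes of [Q] is at least 2 to their number, and t + 1 <= 2^t. *)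
Lemma size_primes_le (Q m t : nat) : (0 < Q)%N -> (Q < t.+1 ^ m)%N -> (size (primes Q) <= t * m)%N.
Proof.
move=> Q0 hQ; rewrite -(@leq_exp2l 2) //.
apply: (@leq_trans (\prod_(p <- primes Q) p)).
  by apply: size_primes_exp; apply/allP=> p; rewrite mem_primes => /andP[/prime_gt1].
apply: (@leq_trans Q).
  apply: dvdn_leq => //; apply: dvdn_prod_primes; first exact: primes_uniq.
    by apply/allP=> p; rewrite mem_primes => /andP[].
  by apply/allP=> p; rewrite mem_primes => /and3P[].
apply: ltnW; apply: leq_trans hQ _; rewrite expnM.
by apply: leq_wexp2r; apply: ltn_expl.
Qed.

(** Let y = log_4 t, rounded down. If s primes of [Q] exceed y, then (y+1)^s <= Q < t^(2m) <
    4^(2m(y+1)), while the size of [t] forces y + 1 >= 4^(4m); compare exponents. *)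
Lemma size_mid_primes_le (Q m t : nat) : (0 < Q)%N -> (1 < t)%N ->
  (Q < t.+1 ^ m)%N -> (4 ^ (4 ^ (4 * m)) <= t)%N -> 
  ((size [seq p <- primes Q | trunc_log 4 t < p]).*2 <= (trunc_log 4 t).+1)%N.
Proof.
move=> Q0 t1 hQ ht; set y := trunc_log 4 t; set s := filter _ _.
have y1 : (4 ^ (4 * m) <= y.+1)%N by apply: leqW; apply: trunc_log_max.
have : (y.+1 ^ size s < 4 ^ (2 * m * y.+1))%N.
  apply: (@leq_ltn_trans Q).
    apply: (@leq_trans (\prod_(p <- s) p)).
      by apply: size_primes_exp; apply/allP=> p; rewrite mem_filter => /andP[].
    apply: dvdn_leq => //; apply: dvdn_prod_primes.
    - by rewrite filter_uniq ?primes_uniq.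
    - by apply/allP=> p; rewrite mem_filter mem_primes => /andP[_ /andP[]].
    - by apply/allP=> p; rewrite mem_filter mem_primes => /andP[_ /and3P[]].
  apply: leq_trans hQ _; have -> : (2 * m * y.+1 = y.+1 * 2 * m)%N by ring.
  rewrite expnM; apply: leq_wexp2r; apply: (@leq_trans (t ^ 2)).
    by rewrite expnS expn1; nia.
  by rewrite expnM; apply/leq_wexp2r/ltnW/trunc_log_ltn.
move=> h; have : (4 ^ (4 * m * size s) < 4 ^ (2 * m * y.+1))%N.
  by apply: leq_ltn_trans h; rewrite expnM; apply: leq_wexp2r.
rewrite ltn_exp2l //; nia.
Qed.

(** Since D/k <= r/t^6 and (w+1)^2 Y <= t^4, both errors contribute O(q/t^2); altogether the left
    side is at most 4 r n (r+1) q/t^2. *)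
Lemma sieve_inequality (n r t q D k w Y : nat) :
  (0 < r)%N -> (8 * r ^ 2 * n < t)%N -> (0 < t)%N -> (t ^ 5 <= q)%N ->
  (w.+1 ^ 2 <= t ^ 3)%N -> (Y <= t)%N -> (D <= r * t ^ (5 * n + 1))%N -> k = (t ^ (5 * n + 7))%N ->
  2 * r%:R * w.+1%:R *
    (w.+1%:R * Y%:R * (2 * D%:R * n%:R * q%:R / k%:R) + w%:R * (n%:R + n%:R * q%:R / t%:R ^+ 5))
  < q%:R :> rat.
Proof.
move=> r0 rt t0 tq wt Yt Dt kE.
have T0 : 0 < t%:R :> rat by rewrite ltr0n.
have Q0 : 0 < q%:R :> rat by rewrite ltr0n (leq_trans _ tq) // expn_gt0 t0.
have r1 : 1 <= r%:R :> rat by rewrite ler1n.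
have kR : k%:R = t%:R ^+ (5 * n + 1) * t%:R ^+ 6 :> rat by rewrite kE natrX -exprD -addnA.
have tn0 j : 0 < t%:R ^+ j :> rat by rewrite exprn_gt0.
have e1 : 2 * D%:R * n%:R * q%:R / k%:R <= 2 * r%:R * n%:R * q%:R / t%:R ^+ 6 :> rat.
  have DR : D%:R <= r%:R * t%:R ^+ (5 * n + 1) :> rat by rewrite -natrX -natrM ler_nat.
  rewrite kR; set s := t%:R ^+ (5 * n + 1) in DR *; have s0 : 0 < s by exact: tn0.
  have -> : 2 * r%:R * n%:R * q%:R / t%:R ^+ 6 = 2 * (r%:R * s) * n%:R * q%:R / (s * t%:R ^+ 6) :> rat.
    move: (t%:R ^+ 6) (tn0 6%N) => u u0; field; by rewrite !gt_eqF.
  apply: ler_wpM2r; first by rewrite invr_ge0 ltW // mulr_gt0.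
  apply: ler_wpM2r; first exact: ltW.
  by apply: ler_wpM2r => //; apply: ler_wpM2l.
have e2 : n%:R + n%:R * q%:R / t%:R ^+ 5 <= 2 * n%:R * q%:R / t%:R ^+ 5 :> rat.
  have : n%:R <= n%:R * q%:R / t%:R ^+ 5 :> rat.
    by rewrite ler_pdivlMr // ler_wpM2l // -natrX ler_nat.
  move: (t%:R ^+ 5)^-1 => u; lra.
have YR : Y%:R <= t%:R :> rat by rewrite ler_nat.
have WR : w.+1%:R ^+ 2 <= t%:R ^+ 3 :> rat by rewrite -!natrX ler_nat.
have wW : w%:R <= w.+1%:R :> rat by rewrite ler_nat.
have rn : 8 * r%:R ^+ 2 * n%:R < t%:R :> rat by rewrite -natrX -!natrM ltr_nat.
pose e := 2 * r%:R * n%:R * q%:R / t%:R ^+ 6 : rat.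
pose e' := 2 * n%:R * q%:R / t%:R ^+ 5 : rat.
have ee0 : 0 <= e by rewrite /e !mulr_ge0 // invr_ge0 ltW.
have ee0' : 0 <= e' by rewrite /e' !mulr_ge0 // invr_ge0 ltW.
apply: (@le_lt_trans _ _ (2 * r%:R * w.+1%:R * (w.+1%:R * t%:R * e + w.+1%:R * e'))).
  apply: ler_wpM2l; first by rewrite !mulr_ge0.
  apply: lerD.
    apply: (@le_trans _ _ (w.+1%:R * Y%:R * e)); first by rewrite ler_wpM2l // mulr_ge0.
    by rewrite ler_wpM2r // ler_wpM2l.
  apply: (@le_trans _ _ (w%:R * e')); first by rewrite ler_wpM2l.
  by rewrite ler_wpM2r.
have -> : 2 * r%:R * w.+1%:R * (w.+1%:R * t%:R * e + w.+1%:R * e') =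
  w.+1%:R ^+ 2 * (2 * r%:R * (t%:R * e + e')) by move: (w.+1%:R : rat) => W; ring.
apply: (@le_lt_trans _ _ (t%:R ^+ 3 * (2 * r%:R * (t%:R * e + e')))).
  by rewrite ler_wpM2r // !mulr_ge0 ?addr_ge0 // mulr_ge0.
have -> : t%:R ^+ 3 * (2 * r%:R * (t%:R * e + e')) = q%:R * (4 * r%:R * n%:R * (r%:R + 1) / t%:R ^+ 2).
  by rewrite /e /e'; move: (t%:R : rat) T0 => u u0; field; rewrite gt_eqF.
rewrite -[ltRHS]mulr1 ltr_pM2l // ltr_pdivrMr // mul1r.
apply: (@le_lt_trans _ _ (8 * r%:R ^+ 2 * n%:R)).
  have n0 : 0 <= n%:R :> rat by [].
  have : 0 <= (r%:R - 1) * (r%:R * n%:R) :> rat by rewrite mulr_ge0 ?subr_ge0 // mulr_ge0.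
  by move: (r%:R : rat) (n%:R : rat) => a b; lra.
apply: lt_le_trans rn _; rewrite expr2 -[leLHS]mul1r ler_wpM2r //.
by rewrite ler1n.
Qed.

(* With t the integral part of the e-th root of q, every power-saving estimate becomes a
   polynomial inequality in t, and the logarithm of q is at most e * t. *)
Lemma line_r_primitive (F : finFieldType) (L : fieldExtType F) (n r t : nat) :
  let e := (20 * n + 21)%N in
  \dim {:L} = n -> (1 < n)%N -> (0 < r)%N -> (r %| #|F| ^ n - 1)%N ->
  (t ^ e <= #|F|)%N -> (#|F| < t.+1 ^ e)%N ->
  (4 ^ (4 ^ (4 * (e * n))) <= t)%N -> (8 * r ^ 2 * n < t)%N -> ((e * n).+1 ^ 2 <= t)%N ->
  line_property L r.
Proof.
move=> e dL n1 r0 rQ tq qt t4 t8 te alpha theta al0 gen.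
set q := #|F| in rQ tq qt *.
have q1 : (1 < q)%N := card_finNzRing_gt1 F.
have n0 : (0 < n)%N := ltnW n1.
set Q := (q ^ n - 1)%N in rQ *.
have qn1 : (1 < q ^ n)%N by rewrite -(exp1n n) ltn_exp2r.
have Q0 : (0 < Q)%N by rewrite subn_gt0.
have Qq : (Q < q ^ n)%N by rewrite /Q; lia.
have rt : (r < t)%N by apply: leq_trans t8; rewrite ltnS; nia.
have nt : (n < t)%N by apply: leq_trans t8; rewrite ltnS; nia.
have t1 : (1 < t)%N by lia.
have QT : (Q < t.+1 ^ (e * n))%N.
  by apply: leq_trans Qq _; rewrite expnM; apply/leq_wexp2r/ltnW.
pose beta (x : F) := alpha * (theta + x%:A).
have b0 x : beta x != 0 by rewrite mulf_neq0 // generator_add_neq0 // dL.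
have bQ x : beta x ^+ Q = 1.
  have h := card_fieldExt_expf (beta x); rewrite dL -/q in h.
  apply: (mulfI (b0 x)); rewrite -exprS mulr1 /Q subn1 prednK ?h //; exact: ltnW.
have ord x : exists m, m.-primitive_root (beta x) /\ (m %| Q)%N.
  by have [m h1 h2] := prim_order_exists Q0 (bQ x); exists m.
case/fin_all_exists: ord => o ho.
(* This is the index of the subgroup generated by [beta x], so [f x = r] says that [beta x] is
   [r]-primitive. *)
pose f x := (Q %/ o x)%N.
have dvd_f d x : (d %| Q)%N -> (d %| f x)%N = (beta x ^+ (Q %/ d) == 1).
  move=> dQ; case: (ho x) => h1 h2.
  by rewrite -(prim_order_dvd h1) /f !dvdn_divRL // mulnC.
have [x fx] : exists x, f x = r; last first.
  exists x; split; first exact: b0.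
  case: (ho x) => h1 h2; rewrite dL -/q -/Q.
  have -> : (Q %/ r)%N = o x by rewrite -fx /f divnA // mulKn.
  split; first exact: prim_order_gt0 h1.
  split; first exact: prim_expr_order h1.
  by move=> m m0 mo; rewrite -(prim_order_dvd h1) gtnNdvd.
pose y := trunc_log 4 t.
have yt : (4 ^ y <= t)%N by apply: trunc_logP => //; apply: ltnW.
(* A prime beyond [T] exceeds (t^5)^n, so that the count for large primes saves a factor t^5. *)
pose T := (t ^ (5 * n))%N.
pose D := (r * 4 ^ y * T)%N.
pose k := (t ^ (5 * n + 7))%N.
have k0 : (0 < k)%N by rewrite expn_gt0 ltnW.
have Dt : (D <= r * t ^ (5 * n + 1))%N.
  by rewrite /D -mulnA leq_mul2l addn1 expnS leq_mul ?orbT.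
(* This fixes [e]: with n + 1 <= t, D <= t^(5n+2) and k + 1 <= t^(5n+8), the exponent is 1 + 2(5n+2)
   + 2(5n+8) = 20n + 21. *)
have param : (n.+1 * D ^ 2 * k.+1 ^ 2 <= q)%N.
  apply: leq_trans tq.
  apply: (@leq_trans (t * (t ^ (5 * n + 2)) ^ 2 * (t ^ (5 * n + 8)) ^ 2)).
    apply: leq_mul; first apply: leq_mul => //.
      apply: leq_wexp2r; apply: leq_trans Dt _.
      have -> : (5 * n + 2 = (5 * n + 1).+1)%N by lia.
      by rewrite expnS leq_mul // ltnW.
    apply: leq_wexp2r; rewrite -[(5 * n + 8)%N]/(5 * n + (7 + 1))%N addnA addn1 expnS -/k.
    by nia.
  rewrite -!expnM -expnS -expnD leq_exp2l // /e; lia.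
pose Err : rat := 2 * D%:R * n%:R * q%:R / k%:R.
pose H : rat := n%:R + n%:R * q%:R / t%:R ^+ 5.
have H0 : 0 <= H by rewrite addr_ge0 // mulr_ge0 ?mulr_ge0 // invr_ge0 exprn_ge0.
apply: (@sieve_survivor F f q%:R Err H Q D T y r) => //.
- by rewrite ltr0n ltnW.
- by move=> x; rewrite /f; case: (ho x) => _ h; apply/dvdnP; exists (o x); rewrite mulnC divnK.
- move=> d dQ dD.
  have d0 : (0 < d)%N by apply: dvdn_gt0 dQ.
  have -> : [set x | (d %| f x)%N] = [set x | beta x ^+ (Q %/ d) == 1].
    by apply/setP=> x; rewrite !inE dvd_f.
  apply: (@le_trans _ _ (2 * d%:R * n%:R * q%:R / k%:R)).
    apply: card_line_subgroup => //; first by rewrite divnK.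
    apply: leq_trans param; rewrite leq_mul // leq_mul //; exact: leq_wexp2r.
  rewrite /Err ler_wpM2r ?invr_ge0 // ler_wpM2r // ler_wpM2r // ler_wpM2l // ler_nat //.
- move=> p pp pQ Tp.
  have -> : [set x | (p %| f x)%N] = [set x | beta x ^+ (Q %/ p) == 1].
    by apply/setP=> x; rewrite !inE dvd_f.
  have Np : (0 < Q %/ p)%N by rewrite divn_gt0 ?prime_gt0 // dvdn_leq.
  have := bin_card_line_subgroup dL Np al0 gen.
  set h := #|_| => /bin_large_bound.
  move=> /(_ p q (t ^ 5)%N n0); rewrite divnK // -expnM => /(_ Qq (ltnW Tp)) hb.
  have t5 : 0 < t%:R ^+ 5 :> rat by rewrite exprn_gt0 // ltr0n ltnW.
  rewrite -(ler_pM2r t5) /H mulrDl divfK ?gt_eqF //.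
  by rewrite -natrX -!natrM -natrD ler_nat.
- by rewrite expn_gt0 ltnW.
- exact: (@size_mid_primes_le Q (e * n) t).
apply: (@sieve_inequality n r t q D k) => //; first exact: ltnW.
  by apply: leq_trans tq; rewrite leq_exp2l // /e; lia.
have wt := size_primes_le Q0 QT.
apply: (@leq_trans ((e * n).+1 ^ 2 * t ^ 2)); last by rewrite [leqRHS]expnS leq_mul.
rewrite -expnMn; apply: leq_wexp2r.
by rewrite mulSn [(e * n * t)%N]mulnC -add1n leq_add // ltnW.
Qed.

Lemma root_floor (e q t0 : nat) : (0 < e)%N -> (t0 ^ e <= q)%N ->
  exists t, [/\ (t0 <= t)%N, (t ^ e <= q)%N & (q < t.+1 ^ e)%N].
Proof.
move=> e0 h0; have ex : exists t, (t ^ e <= q)%N by exists t0.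
have bd t : (t ^ e <= q)%N -> (t <= q)%N.
  by move=> h; apply: leq_trans h; case: t => // t; rewrite -{1}(expn1 t.+1) leq_pexp2l.
case: (ex_maxnP ex bd) => t ht tmax; exists t; split=> //; first exact: tmax.
by rewrite ltnNge; apply/negP=> /tmax; rewrite ltnn.
Qed.

Theorem theorem3 (n r : nat) (hn : (2 <= n)%N) (hr : (1 <= r)%N) :
  exists Lr Tr : nat, (Tr <= Lr)%N /\
    (forall (F : finFieldType) (L : fieldExtType F),
        \dim {:L} = n -> (Lr < #|F|)%N -> (r %| #|F| ^ n - 1)%N ->
        line_property L r) /\
    (forall (F : finFieldType) (L : fieldExtType F),
        \dim {:L} = n -> (Tr < #|F|)%N -> (r %| #|F| ^ n - 1)%N ->
        translate_property L r).
Proof.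
pose e := (20 * n + 21)%N.
(* The sum dominates each of the three lower bounds imposed on [t]. *)
pose t0 := (4 ^ (4 ^ (4 * (e * n))) + (8 * r ^ 2 * n).+1 + (e * n).+1 ^ 2)%N.
have line (F : finFieldType) (L : fieldExtType F) :
    \dim {:L} = n -> (t0 ^ e < #|F|)%N -> (r %| #|F| ^ n - 1)%N -> line_property L r.
  move=> dL hq rQ; have e0 : (0 < e)%N by rewrite /e addnS.
  have [t [tt0 tq qt]] := root_floor e0 (ltnW hq).
  apply: (@line_r_primitive F L n r t) => //; apply: leq_trans tt0; rewrite /t0 -/e; lia.
(* One threshold serves both properties: a set of translates is the line with alpha = 1. *)
exists (t0 ^ e)%N, (t0 ^ e)%N; split=> //; split=> // F L dL hq rQ theta gen.
have [x hx] := line F L dL hq rQ 1 theta (oner_neq0 _) gen.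
by exists x; rewrite mul1r in hx.
Qed.
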